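(* Let $G$ be Baumslag's metabelian group, given by the presentation $G = \langle a, s, t \mid [s,t],\ [t^{-1} a t,\, a],\ s^{-1} a s = a\, t^{-1} a t \rangle$, and let $H$ be the subgroup of $G$ generated by $a$ and $t$. Then $H$ has at least exponential distortion in $G$.
   Context: Commutators are $[x,y] = x y x^{-1} y^{-1}$. The subgroup $H = \langle a, t\rangle$ of $G$ is isomorphic to the wreath product $\mathbb{Z} \wr \mathbb{Z} = \langle a, t \mid [t^{-i} a t^{i},\, t^{-j} a t^{j}],\ i, j \in \mathbb{Z}\rangle$, with $a$ and $t$ corresponding to the generators of the same names. For a group $K$ with finite generating set $S$, $|g|_K$ denotes the word length of $g \in K$ with respect to $S$, i.e. the least length of a word in $S \cup S^{-1}$ representing $g$. Here $|\cdot|_G$ is taken with respect to $\{a, s, t\}$ and $|\cdot|_H$ with respect to $\{a, t\}$. The distortion function of $H$ in $G$ is $D(n) = \max\{\, |g|_H : g \in H,\ |g|_G \le n \,\}$. The subgroup $H$ has at least exponential distortion in $G$ if $D$ grows at least exponentially, i.e. there exist a constant $c > 1$ and an integer $N$ such that $D(n) \ge c^{n}$ for all $n \ge N$. *)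

(* Defs.v *)
From HB Require Import structures.
From mathcomp Require Import all_boot all_order all_algebra.
From mathcomp Require Import mathcomp_extra boolp classical_sets cardinality.
From mathcomp Require Import reals.

Set Implicit Arguments.
Unset Strict Implicit.
Unset Printing Implicit Defensive.

Local Open Scope group_scope.
Local Open Scope classical_set_scope.
Local Open Scope quotient_scope.

(* The letter (x, false) stands for x and (x, true) for its formal inverse. *)
Definition letter (X : choiceType) : choiceType := (X * bool)%type.
Definition word (X : choiceType) : choiceType := seq (letter X).

Definition linv (X : choiceType) (l : letter X) : letter X := (l.1, ~~ l.2).
Definition winv (X : choiceType) (w : word X) : word X :=
  rev [seq linv l | l <- w].
Definition wcomm (X : choiceType) (u v : word X) : word X :=
  u ++ v ++ winv u ++ winv v.

(* The congruence on words generated by free cancellation and by the defining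
   relations u = v, for (u, v) in rels. *)
Inductive pres_eq (X : choiceType) (rels : seq (word X * word X)) :
    word X -> word X -> Prop :=
| pres_eq_refl u : pres_eq rels u u
| pres_eq_sym u v : pres_eq rels u v -> pres_eq rels v u
| pres_eq_trans v u w : pres_eq rels u v -> pres_eq rels v w -> pres_eq rels u w
| pres_eq_cat u u' v v' :
    pres_eq rels u u' -> pres_eq rels v v' -> pres_eq rels (u ++ v) (u' ++ v')
| pres_eq_cancel l : pres_eq rels [:: l; linv l] [::]
| pres_eq_rel u v : (u, v) \in rels -> pres_eq rels u v.

Section PresentedGroup.
Variables (X : choiceType) (rels : seq (word X * word X)).
Implicit Types u v w : word X.

Definition pres_eqb u v : bool := `[< pres_eq rels u v >].

Lemma pres_eqb_refl : reflexive pres_eqb.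
Proof. by move=> u; apply/asboolP; apply: pres_eq_refl. Qed.

Lemma pres_eqb_sym : symmetric pres_eqb.
Proof.
by move=> u v; apply/asboolP/asboolP => /pres_eq_sym.
Qed.

Lemma pres_eqb_trans : transitive pres_eqb.
Proof.
move=> v u w /asboolP uv /asboolP vw; apply/asboolP.
exact: pres_eq_trans uv vw.
Qed.

Canonical pres_equiv :=
  EquivRel pres_eqb pres_eqb_refl pres_eqb_sym pres_eqb_trans.

Definition presented := {eq_quot pres_equiv}.
HB.instance Definition _ := Choice.on presented.

Definition pres_class w : presented := \pi_presented w.

Lemma pres_classP u v : pres_class u = pres_class v <-> pres_eq rels u v.
Proof.
split=> [/eqP|uv]; last by apply/eqmodP/asboolP.
by rewrite /pres_class eqmodE => /asboolP.
Qed.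

Lemma pres_reprK (x : presented) : pres_class (repr x) = x.
Proof. exact: reprK. Qed.

Lemma pres_eq_repr u : pres_eq rels (repr (pres_class u)) u.
Proof. by apply/pres_classP; rewrite pres_reprK. Qed.

Lemma linvK : involutive (@linv X).
Proof. by case=> x b; rewrite /linv /= negbK. Qed.

Lemma winv_cons l u : winv (l :: u) = winv u ++ [:: linv l].
Proof. by rewrite /winv /= rev_cons -cats1. Qed.

Lemma winv_cat u v : winv (u ++ v) = winv v ++ winv u.
Proof. by rewrite /winv map_cat rev_cat. Qed.

Lemma winvK : involutive (@winv X).
Proof.
by move=> u; rewrite /winv map_rev revK -map_comp map_id_in // => l _ /=;
  rewrite linvK.
Qed.

Lemma pres_eq_mulV u : pres_eq rels (u ++ winv u) [::].
Proof.
elim: u => [|l u IHu]; first exact: pres_eq_refl.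
rewrite winv_cons catA -[(l :: u) ++ _]/([:: l] ++ (u ++ winv u)).
apply: pres_eq_trans (pres_eq_cancel rels l).
rewrite -[[:: l; linv l]]/([:: l] ++ [::] ++ [:: linv l]) -catA.
apply: pres_eq_cat; first exact: pres_eq_refl.
by apply: pres_eq_cat => //; exact: pres_eq_refl.
Qed.

Lemma pres_eq_Vmul u : pres_eq rels (winv u ++ u) [::].
Proof. by have := pres_eq_mulV (winv u); rewrite winvK. Qed.

Lemma pres_eq_winv u v : pres_eq rels u v -> pres_eq rels (winv u) (winv v).
Proof.
move=> uv; apply: (@pres_eq_trans _ _ (winv u ++ v ++ winv v)).
  rewrite -{1}[winv u]cats0; apply: pres_eq_cat; first exact: pres_eq_refl.
  exact/pres_eq_sym/pres_eq_mulV.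
rewrite catA -{2}[winv v]cat0s; apply: pres_eq_cat; last exact: pres_eq_refl.
apply: pres_eq_trans (pres_eq_Vmul u).
by apply: pres_eq_cat; [exact: pres_eq_refl|exact: pres_eq_sym].
Qed.

Definition pres_mul (x y : presented) : presented :=
  pres_class (repr x ++ repr y).
Definition pres_one : presented := pres_class [::].
Definition pres_inv (x : presented) : presented := pres_class (winv (repr x)).

Lemma pres_mulE u v :
  pres_mul (pres_class u) (pres_class v) = pres_class (u ++ v).
Proof. by apply/pres_classP; apply: pres_eq_cat; apply: pres_eq_repr. Qed.

Lemma pres_invE u : pres_inv (pres_class u) = pres_class (winv u).
Proof. by apply/pres_classP; apply: pres_eq_winv; apply: pres_eq_repr. Qed.

Lemma pres_mulA : associative pres_mul.
Proof.
by move=> x y z; rewrite -[x]pres_reprK -[y]pres_reprK -[z]pres_reprK !pres_mulE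
  catA.
Qed.

Lemma pres_mul1 : left_id pres_one pres_mul.
Proof. by move=> x; rewrite -[x]pres_reprK pres_mulE. Qed.

Lemma pres_mulr1 : right_id pres_one pres_mul.
Proof. by move=> x; rewrite -[x]pres_reprK pres_mulE cats0. Qed.

Lemma pres_mulV : left_inverse pres_one pres_inv pres_mul.
Proof.
move=> x; rewrite -[x]pres_reprK pres_invE pres_mulE.
by apply/pres_classP; apply: pres_eq_Vmul.
Qed.

Lemma pres_mulVr : right_inverse pres_one pres_inv pres_mul.
Proof.
move=> x; rewrite -[x]pres_reprK pres_invE pres_mulE.
by apply/pres_classP; apply: pres_eq_mulV.
Qed.

HB.instance Definition _ := isGroup.Build presented
  pres_mulA pres_mul1 pres_mulr1 pres_mulV pres_mulVr.

Definition pres_gen (x : X) : presented := pres_class [:: (x, false)].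

Definition weval (K : groupType) (f : X -> K) (w : word X) : K :=
  \prod_(l <- w) (if l.2 then (f l.1)^-1 else f l.1).

Lemma weval_cat (K : groupType) (f : X -> K) u v :
  weval f (u ++ v) = weval f u * weval f v.
Proof. by rewrite /weval big_cat. Qed.

Lemma pres_lift (K : groupType) (f : X -> K) :
    (forall u v, (u, v) \in rels -> weval f u = weval f v) ->
  exists h : {multiplicative presented -> K}, forall x, h (pres_gen x) = f x.
Proof.
move=> f_rels.
have weval_eq u v : pres_eq rels u v -> weval f u = weval f v.
  elim=> {u v} [//|//|v u w _ -> _ -> //|u u' v v' _ IHu _ IHv|[x b]|].
  - by rewrite !weval_cat IHu IHv.
  - rewrite /weval /linv !big_cons big_nil /= mulg1.
    by case: b; rewrite /= ?mulVg ?mulgV.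
  - exact: f_rels.
pose h (x : presented) := weval f (repr x).
have hM : {morph h : x y / x * y}.
  move=> x y; rewrite /h -weval_cat; apply: weval_eq.
  exact: pres_eq_repr.
pose hm := isMultiplicative.Build _ _ h hM.
pose hH : {multiplicative presented -> K} := HB.pack h hm.
exists hH => x; rewrite /= /h (weval_eq _ _ (pres_eq_repr _)).
by rewrite /weval big_seq1.
Qed.

Lemma pres_class_cat u v : pres_class (u ++ v) = pres_class u * pres_class v.
Proof. by rewrite -[LHS]pres_mulE. Qed.

Lemma pres_classV u : pres_class (winv u) = (pres_class u)^-1.
Proof. by rewrite -[LHS]pres_invE. Qed.

Lemma pres_class_weval w : weval pres_gen w = pres_class w.
Proof.
elim: w => [|[x b] w IHw]; first by rewrite /weval big_nil.
rewrite -cat1s weval_cat IHw pres_class_cat /weval big_seq1 /=.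
by case: b => //; rewrite -pres_classV.
Qed.

Lemma pres_gen_rel u v :
  (u, v) \in rels -> weval pres_gen u = weval pres_gen v.
Proof.
by move=> uv; rewrite !pres_class_weval; apply/pres_classP/pres_eq_rel.
Qed.

End PresentedGroup.

Section Distortion.
Variable K : groupType.
Implicit Types (A S T : set K) (g : K).

Definition is_subgroup A := A 1 /\ forall x y, A x -> A y -> A (x * y^-1).

Definition generated S : set K := smallest is_subgroup S.

Definition word_over S (w : seq K) :=
  forall x, x \in w -> S x \/ S x^-1.

(* Lengths of the words in S and its inverse that represent g. *)
Definition word_lengths S g : set nat :=
  [set n | exists w, [/\ word_over S w, \prod_(x <- w) x = g & size w = n]].

Lemma word_over_cat S u v :
  word_over S u -> word_over S v -> word_over S (u ++ v).
Proof. by move=> Su Sv x; rewrite mem_cat => /orP[/Su|/Sv]. Qed.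

Lemma word_lengths_neq0 S g : generated S g -> word_lengths S g !=set0.
Proof.
move=> /(_ [set h | word_lengths S h !=set0]); apply.
split=> [|x Sx /=]; last first.
  exists 1%N, [:: x]; split=> //; last by rewrite big_seq1.
  by move=> y; rewrite inE => /eqP ->; left.
split=> [|x y [_ [u [Su <- _]]] [_ [v [Sv <- _]]]] /=.
  by exists 0%N, [::]; split=> //; rewrite big_nil.
exists (size (u ++ rev [seq z^-1 | z <- v])), (u ++ rev [seq z^-1 | z <- v]).
split=> //.
  apply: word_over_cat => // z; rewrite mem_rev => /mapP[z' /Sv Sz' ->].
  by rewrite invgK; case: Sz'; [right|left].
rewrite big_cat; congr (_ * _).
elim: v {Sv} => [|z v IHv]; first by rewrite !big_nil invg1.
by rewrite /= rev_cons -cats1 big_cat big_seq1 IHv big_cons invgM.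
Qed.

(* The default value 0 is only taken when g is not in the subgroup generated
   by S (word_lengthP).  As words over S stay in that subgroup, word_length S
   is also the word length, with respect to S, in the subgroup itself. *)
Definition word_length S g : nat :=
  xget 0%N (word_lengths S g `&` lbound (word_lengths S g)).

(* Distortion of the subgroup generated by T in K, where K is generated by S:
   the largest word length with respect to T of an element of that subgroup of
   word length at most n with respect to S.  For finite S the maximum exists
   (distortionP) and the default value 0 is not used. *)
Definition distorted_lengths S T (n : nat) : set nat :=
  [set word_length T g | g in [set g | generated T g /\
                                       (word_length S g <= n)%N]].

Definition distortion S T (n : nat) : nat :=
  xget 0%N (distorted_lengths S T n `&` ubound (distorted_lengths S T n)).

Lemma word_lengthP S g : generated S g ->
  word_lengths S g (word_length S g) /\
  forall m, word_lengths S g m -> (word_length S g <= m)%N.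
Proof.
move=> /word_lengths_neq0[m0 Lm0]; rewrite /word_length.
have exL : exists m, `[< word_lengths S g m >] by exists m0; apply/asboolP.
case: (ex_minnP exL) => m /asboolP Lm m_min; case: xgetP => [k _ [Lk kP] //|].
move=> /(_ m) /not_andP[//|]; case=> k Lk; rewrite leEnat.
exact/m_min/asboolP.
Qed.

Lemma finite_sphere S n :
  finite_set S -> finite_set [set g | word_lengths S g n].
Proof.
move=> finS; elim: n => [|n IHn].
  apply: (@sub_finite_set _ _ [set 1]) => // g [w [_ <- /size0nil ->]].
  by rewrite big_nil.
pose S' := S `|` [set x^-1 | x in S].
apply: (@sub_finite_set _ _
    [set x * y | x in S' & y in [set g | word_lengths S g n]]).
  move=> g [w [Sw <-]]; case: w Sw => [|x w] // Sw [sw]; rewrite big_cons /=.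
  exists x.
    have [|Sx|SVx] := Sw x; rewrite ?mem_head //; first by left.
    by right; exists x^-1; rewrite ?invgK.
  exists (\prod_(y <- w) y) => //; exists w; split=> // y wy.
  by apply: Sw; rewrite inE wy orbT.
apply: finite_image2 => //; rewrite finite_setU; split=> //.
exact: finite_image.
Qed.

Lemma distortionP S T n : finite_set S -> generated S = setT ->
  distorted_lengths S T n (distortion S T n) /\
  forall m, distorted_lengths S T n m -> (m <= distortion S T n)%N.
Proof.
move=> finS genS; set L := distorted_lengths S T n.
have genE g : generated S g by rewrite genS.
have finL : finite_set L.
  apply: finite_image; apply: (@sub_finite_set _ _
      (\bigcup_(k in `I_n.+1) [set g | word_lengths S g k])).
    move=> g [_ gn]; exists (word_length S g) => //=.
    by have [] := word_lengthP (genE g).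
  by apply: bigcup_finite => // k _; apply: finite_sphere.
have L0 : L !=set0.
  exists (word_length T 1), 1 => //; split; first by move=> A [[]].
  have [_ /(_ 0%N) le0] := word_lengthP (genE 1).
  by apply: leq_trans (le0 _) _ => //; exists [::]; split=> //; rewrite big_nil.
have [r Lr] : exists r : seq nat, L = [set` r] by exact/finite_seqP.
have exL : exists m, `[< L m >] by have [m Lm] := L0; exists m; apply/asboolP.
have ubL m : `[< L m >] -> (m <= \max_(i <- r) i)%N.
  by rewrite Lr => /asboolP rm; rewrite (big_rem m rm) /= leq_max leqnn.
rewrite /distortion -/L; case: (ex_maxnP exL ubL) => m /asboolP Lm m_max.
case: xgetP => [k _ [Lk kP] //|/(_ m) /not_andP[//|]]; case=> k Lk.
by rewrite leEnat; apply/m_max/asboolP.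
Qed.

End Distortion.

Definition at_least_exponential (R : realType) (D : nat -> nat) :=
  exists2 c : R, (1 < c)%R &
    exists N : nat, forall n : nat, (N <= n)%N -> (c ^+ n <= (D n)%:R)%R.

Inductive baumslag_gen := Ga | Gs | Gt.

Definition nat_of_baumslag_gen (x : baumslag_gen) : nat :=
  match x with Ga => 0 | Gs => 1 | Gt => 2 end.
Definition baumslag_gen_of_nat (n : nat) : baumslag_gen :=
  match n with 0 => Ga | 1 => Gs | _ => Gt end.
Lemma nat_of_baumslag_genK :
  cancel nat_of_baumslag_gen baumslag_gen_of_nat.
Proof. by case. Qed.
HB.instance Definition _ :=
  Choice.copy baumslag_gen (can_type nat_of_baumslag_genK).

Definition baumslag_rels : seq (word baumslag_gen * word baumslag_gen) :=
  let a := [:: (Ga, false)] in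
  let s := [:: (Gs, false)] in
  let t := [:: (Gt, false)] in
  [:: (wcomm s t, [::]);
      (wcomm (winv t ++ a ++ t) a, [::]);
      (winv s ++ a ++ s, a ++ winv t ++ a ++ t)].

Definition baumslag : groupType := presented baumslag_rels.

Definition ba : baumslag := pres_gen baumslag_rels Ga.
Definition bs : baumslag := pres_gen baumslag_rels Gs.
Definition bt : baumslag := pres_gen baumslag_rels Gt.

Lemma generated_baumslag : generated [set ba; bs; bt] = setT.
Proof.
apply/seteqP; split=> // g _ A [[A1 AB] SA].
have AV x : A x -> A x^-1 by move=> Ax; rewrite -[x^-1]mul1g; apply: AB.
have AM x y : A x -> A y -> A (x * y).
  by move=> Ax Ay; rewrite -[y]invgK; apply: AB => //; apply: AV.
have Agen x : A (pres_gen baumslag_rels x).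
  by apply: SA; case: x; [left; left|left; right|right].
rewrite -[g]pres_reprK -pres_class_weval /weval.
elim: (repr g) => [|[x b] w IHw]; first by rewrite big_nil.
by rewrite big_cons; apply: AM => //; case: b => /=; [apply: AV|]; apply: Agen.
Qed.

Lemma finite_baumslag_gens : finite_set [set ba; bs; bt].
Proof. by rewrite !finite_setU; do !split; apply: finite_set1. Qed.

(* Main.v *)
From HB Require Import structures.
Require Import Defs.
From mathcomp Require Import all_boot all_order all_algebra.
From mathcomp Require Import classical_sets reals.
From mathcomp Require Import ring lra zify.

(** Conjugation by [s] maps [a] to [a * a ^ t] and fixes [t], so it maps [H]
    into itself; hence [a ^ (s ^+ m)] lies in [H], although a word in [a], [s],
    [t] of length only [2 m + 1] spells it out.  In [H] it is the product of the
    [a ^ (t ^+ i)] with the binomial multiplicities ['C(m, i)], so any word in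
    [a], [t] for it should use at least [2 ^ m] letters [a].

    A quotient of [G] proves this last point.  Killing [t] turns the relations
    of [G] into [s^-1 a s = a ^+ 2], which holds in the group of affine maps
    [x |-> 2 ^ k x + b] of the rational line, with [a] the translation by [1]
    and [s] the scaling by [1 / 2] ([affine_of_baumslag]).  Every letter of a
    word in [a], [t] moves the origin by at most [1] and does not scale, so the
    length of the word bounds the translation it represents
    ([affine_word_bound]); but [a ^ (s ^+ m)] acts as the translation by
    [2 ^ m] ([affine_of_conj]).  So the distortion of [H] at [2 m + 1] is at
    least [2 ^ m]. *)

Set Implicit Arguments.
Unset Strict Implicit.
Unset Printing Implicit Defensive.

Import Order.TTheory GRing.Theory Num.Theory.
Local Open Scope classical_set_scope.

(** The pair [(b, k)] stands for the map [x |-> 2 ^ k x + b]. *)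
Definition dyadic_affine : Type := (rat * int)%type.

HB.instance Definition _ := Choice.on dyadic_affine.

Section DyadicAffine.
Local Open Scope ring_scope.
Implicit Types f g : dyadic_affine.

Definition affine_mul f g : dyadic_affine :=
  (f.1 + 2%:Q ^ f.2 * g.1, f.2 + g.2).
Definition affine_one : dyadic_affine := (0, 0).
Definition affine_inv f : dyadic_affine := (- (2%:Q ^ (- f.2) * f.1), - f.2).

Lemma affine_mulA : associative affine_mul.
Proof.
move=> [b k] [c l] [d m]; rewrite /affine_mul /= expfzDr //.
by congr (_, _); ring.
Qed.

Lemma affine_mul1 : left_id affine_one affine_mul.
Proof. by move=> [b k]; rewrite /affine_mul /= expr0z mul1r !add0r. Qed.

Lemma affine_mulr1 : right_id affine_one affine_mul.
Proof. by move=> [b k]; rewrite /affine_mul /= mulr0 !addr0. Qed.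

Lemma affine_mulV : left_inverse affine_one affine_inv affine_mul.
Proof. by move=> [b k]; rewrite /affine_mul /= !addNr. Qed.

Lemma affine_mulVr : right_inverse affine_one affine_inv affine_mul.
Proof.
move=> [b k]; rewrite /affine_mul /= mulrN mulrA -expfzDr // subrr expr0z.
by rewrite mul1r subrr.
Qed.

HB.instance Definition _ := isGroup.Build dyadic_affine
  affine_mulA affine_mul1 affine_mulr1 affine_mulV affine_mulVr.

Definition translation (b : rat) : dyadic_affine := (b, 0).

Lemma translationM b c :
  (translation b * translation c)%g = translation (b + c).
Proof. by rewrite [LHS]/(affine_mul _ _) /affine_mul /= expr0z mul1r addr0. Qed.

Lemma translationV b : ((translation b)^-1)%g = translation (- b).
Proof.
by rewrite [LHS]/(affine_inv _) /affine_inv /= oppr0 expr0z mul1r.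
Qed.

Definition halving : dyadic_affine := (0, -1).

Lemma translation_conj_halving b :
  (translation b ^ halving)%g = translation (2%:Q * b).
Proof.
rewrite conjgE [LHS]/(affine_mul (affine_inv _) (affine_mul _ _)).
by rewrite /affine_mul /affine_inv /= mulr0 oppr0 !add0r mulr0 addr0 opprK.
Qed.

End DyadicAffine.

Section Affine.
Local Open Scope group_scope.

(** With [t] sent to [1] the first two relations become trivial and the third
    one says that conjugation by [s] doubles the translation [a]. *)
Lemma affine_of_baumslag :
  exists h : UMagmaMorphism.type baumslag dyadic_affine,
    [/\ h ba = translation 1, h bs = halving & h bt = 1].
Proof.
pose f x : dyadic_affine :=
  match x with Ga => translation 1 | Gs => halving | Gt => 1 end.
have [|h hE] := @pres_lift _ baumslag_rels _ f; last first.
  (* The lifted morphism carries no proof that it preserves the unit, which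
     the morphism lemmas for inverses and conjugates rely on. *)
  have h1 : h 1 = 1 by apply: (mulgI (h 1)); rewrite -gmulfM !mulg1.
  pose hM := isMultiplicative.Build _ _ (h : _ -> _) gmulfM.
  pose h1M := Multiplicative_isUMagmaMorphism.Build _ _ (h : _ -> _) h1.
  pose hU : UMagmaMorphism.type baumslag dyadic_affine :=
    HB.pack (h : _ -> _) hM h1M.
  by exists hU; split; rewrite /= hE.
move=> u v; rewrite !inE => /or3P[] /eqP[-> ->];
  rewrite /weval /wcomm /winv /= !big_cons big_nil /=.
- by rewrite invg1 !(mul1g, mulg1) mulgV.
- by rewrite invg1 !(mul1g, mulg1) !mulgA mulgK mulgV.
- rewrite !(invg1, mul1g, mulg1) -conjgE.
  by rewrite translation_conj_halving translationM.
Qed.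

Section Quotient.
Variable h : UMagmaMorphism.type baumslag dyadic_affine.
Hypotheses (ha : h ba = translation 1) (hs : h bs = halving) (ht : h bt = 1).

Lemma affine_of_conj m : h (ba ^ (bs ^+ m)) = translation (2 ^ m)%:R.
Proof.
elim: m => [|m IHm]; first by rewrite expg0 conjg1 ha.
by rewrite expgSr conjgM gmulfJ IHm hs translation_conj_halving expnS natrM.
Qed.

(** The letters [a] and [t], with their inverses, act as translations by [1],
    [-1] and [0], so the translations of a word add up: no scaling can amplify
    them as long as the letter [s] is absent. *)
Lemma affine_word_bound w : word_over [set ba; bt] w ->
  exists2 b : rat, h (\prod_(x <- w) x) = translation b
    & (`|b| <= (size w)%:R)%R.
Proof.
elim: w => [|x w IHw] Sw; first by exists 0%R; rewrite ?big_nil ?gmulf1.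
have [y wy|b hw b_le] := IHw; first by apply: Sw; rewrite inE wy orbT.
have [c hx c_le] : exists2 c : rat, h x = translation c & (`|c| <= 1)%R.
  have [[->|->]|[|] /(canRL invgK) ->] := Sw x (mem_head _ _).
  - by exists 1%R.
  - by exists 0%R.
  - by exists (- 1)%R; rewrite // gmulfV ha translationV.
  - by exists 0%R; rewrite // gmulfV ht invg1.
exists (c + b)%R; first by rewrite big_cons gmulfM hx hw translationM.
by rewrite /= -add1n natrD (le_trans (ler_normD _ _)) // lerD.
Qed.

End Quotient.

Lemma subgroup_generated (K : groupType) (S : set K) :
  is_subgroup (generated S).
Proof.
split=> [A [[]] //|x y Sx Sy A AS].
by case: (AS) => -[_ AB] _; apply: AB; [apply: Sx|apply: Sy].
Qed.

Lemma generatedV (K : groupType) (S : set K) x :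
  generated S x -> generated S x^-1.
Proof.
by have [S1 SB] := subgroup_generated S; rewrite -[x^-1]mul1g; apply: SB.
Qed.

Lemma generatedM (K : groupType) (S : set K) x y :
  generated S x -> generated S y -> generated S (x * y).
Proof.
move=> Sx /generatedV Sy; have [_ SB] := subgroup_generated S.
by rewrite -[y]invgK; apply: SB.
Qed.

Lemma generated_conj (K : groupType) (S : set K) s :
    (forall x, S x -> generated S (x ^ s)) ->
  forall x, generated S x -> generated S (x ^ s).
Proof.
move=> Ss x /(_ [set y | generated S (y ^ s)]); apply; split=> //.
have [S1 SB] := subgroup_generated S.
by split=> [|y z Sy Sz]; rewrite /= ?conj1g // conjMg conjVg; apply: SB.
Qed.

Lemma conj_a_by_s : ba ^ bs = ba * ba ^ bt.
Proof.
have := @pres_gen_rel _ baumslag_rels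
  [:: (Gs, true); (Ga, false); (Gs, false)]
  [:: (Ga, false); (Gt, true); (Ga, false); (Gt, false)].
by rewrite /weval !big_cons !big_nil /= !mulg1 !conjgE; apply; rewrite !inE.
Qed.

Lemma conj_t_by_s : bt ^ bs = bt.
Proof.
have := @pres_gen_rel _ baumslag_rels
  (wcomm [:: (Gs, false)] [:: (Gt, false)]) [::].
rewrite /weval !big_cons !big_nil /= !mulg1 => /(_ (mem_head _ _)).
rewrite -invgM mulgA -/bs -/bt => /divg1_eq st.
by rewrite conjgE -st mulKg.
Qed.

Lemma conj_in_H m : generated [set ba; bt] (ba ^ (bs ^+ m)).
Proof.
have genT x : [set ba; bt] x -> generated [set ba; bt] x.
  by move=> Tx A [_]; apply.
have Ha : generated [set ba; bt] ba by apply: genT; left.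
have Ht : generated [set ba; bt] bt by apply: genT; right.
elim: m => [|m IHm]; first by rewrite expg0 conjg1.
rewrite expgSr conjgM; apply: generated_conj IHm => x [->|->].
- rewrite conj_a_by_s conjgE; apply: generatedM => //.
  by apply: generatedM; [apply: generatedV|apply: generatedM].
- by rewrite conj_t_by_s.
Qed.

Lemma conj_word_length m :
  (word_length [set ba; bs; bt] (ba ^ (bs ^+ m)) <= m.*2.+1)%N.
Proof.
have [|_] := @word_lengthP _ [set ba; bs; bt] (ba ^ (bs ^+ m)).
  by rewrite generated_baumslag.
apply; exists (nseq m bs^-1 ++ ba :: nseq m bs); split.
- move=> x; rewrite mem_cat inE !mem_nseq => /or3P[/andP[_]|/eqP->|/andP[_]].
  + by move=> /eqP ->; right; rewrite invgK; left; right.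
  + by left; left; left.
  + by move=> /eqP ->; left; left; right.
- have prod_nseq (x : baumslag) : \prod_(y <- nseq m x) y = x ^+ m.
    by rewrite big_nseq -Monoid.iteropE.
  by rewrite big_cat big_cons /= !prod_nseq expVgn conjgE mulgA.
- by rewrite size_cat /= !size_nseq addnS addnn.
Qed.

Lemma conj_word_length_in_H m :
  (2 ^ m <= word_length [set ba; bt] (ba ^ (bs ^+ m)))%N.
Proof.
have [[w [Sw wE <-]] _] := word_lengthP (conj_in_H m).
have [h [ha hs ht]] := affine_of_baumslag.
have [b] := affine_word_bound ha ht Sw.
by rewrite wE (affine_of_conj ha hs) => -[<-]; rewrite normr_nat ler_nat.
Qed.

End Affine.

Lemma distortion_ge n m : (m.*2 < n)%N ->
  (2 ^ m <= distortion [set ba; bs; bt] [set ba; bt] n)%N.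
Proof.
move=> mn; apply: leq_trans (conj_word_length_in_H m) _.
have [_] := distortionP [set ba; bt] n finite_baumslag_gens generated_baumslag.
apply; exists (ba ^ (bs ^+ m))%g => //; split; first exact: conj_in_H.
exact: leq_trans (conj_word_length m) mn.
Qed.

Theorem theorem4p1 (R : realType) :
  at_least_exponential R (distortion [set ba; bs; bt] [set ba; bt]).
Proof.
(* With m = (n - 1) / 2, n >= 3 gives n <= 4 m, and (9 / 8) ^ 4 <= 2. *)
exists (9 / 8)%R; first by lra.
exists 3%N => n n3; pose m := n.-1./2.
apply: (@le_trans _ _ ((2 ^ m)%:R)%R); last first.
  by rewrite ler_nat; apply: distortion_ge; rewrite /m; lia.
apply: (@le_trans _ _ ((9 / 8) ^+ (4 * m))%R).
  by rewrite ler_eXn2l; [rewrite /m; lia|lra].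
by rewrite exprM natrX lerXn2r // ?nnegrE; lra.
Qed.
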